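(* Let $G$ be an infinite commutative group and let $M$ be a mean on $G$ with linear subspace $L$ of medial functions. Then its upper envelope $M^e$ and lower envelope $M_e$ are an upper mean and a lower mean, respectively, and they induce the mean $M$.
   Context: $G$ is an infinite commutative (discrete) group, written additively. An upper mean is a functional $\overline M$ assigning a real number to every bounded function $f:G\to\mathbb{R}$ such that: (norming) $\overline M(f)=c$ if $f\equiv c$; (monotonicity) $f\le g$ implies $\overline M(f)\le\overline M(g)$; (homogeneity) $\overline M(cf)=c\overline M(f)$ for every constant $c\ge0$; (restricted additivity) if $t\in G$ and $g(x)=f(x)+f(x+t)$, then $\overline M(g)=2\overline M(f)$; (subadditivity) $\overline M(f+g)\le\overline M(f)+\overline M(g)$. A lower mean satisfies the same requirements with subadditivity replaced by superadditivity $\underline M(f+g)\ge\underline M(f)+\underline M(g)$. The conjugate lower mean of an upper mean $\overline M$ is $\underline M(f)=-\overline M(-f)$. A functional $M$ defined on a subspace $L$ of the bounded functions is called a mean if there is an upper mean $\overline M$ with conjugate lower mean $\underline M$ such that $\underline M(f)=\overline M(f)$ holds exactly for $f\in L$, and for $f\in L$ this common value is $M(f)$; the functions in $L$ are called medial, and the conjugate pair $\overline M,\underline M$ is said to induce the mean $M$. For a mean $M$ with subspace $L$ of medial functions, the upper and lower envelope are defined for every bounded $f:G\to\mathbb{R}$ by $$M^e(f)=\inf_{g\in L,\ g\ge f}M(g),\qquad M_e(f)=\sup_{g\in L,\ g\le f}M(g).$$ *)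

(* Defs.v *)
From mathcomp Require Import all_boot all_order all_algebra.
From mathcomp Require Import all_classical all_reals all_analysis.
Import Order.TTheory GRing.Theory Num.Theory.
Import numFieldNormedType.Exports.

Set Implicit Arguments.
Unset Strict Implicit.
Unset Printing Implicit Defensive.

Local Open Scope classical_set_scope.
Local Open Scope ring_scope.

(* Functionals on the bounded functions are encoded as total maps
   (G -> R) -> R: every condition below is imposed at bounded functions only,
   and the values elsewhere are irrelevant. *)
Section Means.
Context {G : zmodType} {R : realType}.
Implicit Types (f g : G -> R) (F Mup Mlow M : (G -> R) -> R).
Implicit Types L : set (G -> R).

Record premean F : Prop := Premean {
  premean_norming : forall c : R, F (fun=> c) = c;
  premean_monotone : forall f g, bounded_fun f -> bounded_fun g ->
    (forall x, f x <= g x) -> F f <= F g;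
  premean_homogeneous : forall (c : R) f, 0 <= c -> bounded_fun f ->
    F (fun x => c * f x) = c * F f;
  premean_restricted_additive : forall (t : G) f, bounded_fun f ->
    F (fun x => f x + f (x + t)) = 2 * F f
}.

Definition upper_mean F : Prop :=
  premean F /\
  forall f g, bounded_fun f -> bounded_fun g ->
    F (fun x => f x + g x) <= F f + F g.

Definition lower_mean F : Prop :=
  premean F /\
  forall f g, bounded_fun f -> bounded_fun g ->
    F f + F g <= F (fun x => f x + g x).

Definition conjugate F : (G -> R) -> R := fun f => - F (fun x => - f x).

(* Here M stands for a functional with domain L; its values off L are never
   used. *)
Record induces Mup Mlow L M : Prop := Induces {
  induces_upper : upper_mean Mup;
  induces_conjugate : forall f, bounded_fun f -> Mlow f = conjugate Mup f;
  induces_medial : forall f, bounded_fun f -> (L f <-> Mlow f = Mup f);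
  induces_value : forall f, L f -> M f = Mup f
}.

Record is_mean L M : Prop := IsMean {
  mean_bounded : forall f, L f -> bounded_fun f;
  mean_subspace : submod_closed (fun f => f \in L);
  mean_induced : exists Mup, induces Mup (conjugate Mup) L M
}.

Definition upper_envelope L M : (G -> R) -> R := fun f =>
  inf [set M g | g in [set g | L g /\ forall x, f x <= g x]].

Definition lower_envelope L M : (G -> R) -> R := fun f =>
  sup [set M g | g in [set g | L g /\ forall x, g x <= f x]].

End Means.

(* Main.v *)
Require Import Defs.
From mathcomp Require Import all_boot all_order all_algebra.
From mathcomp Require Import all_classical all_reals all_analysis.
From mathcomp Require Import ring lra.
Local Open Scope classical_set_scope.
Local Open Scope ring_scope.

(** The key point is that [f - f(. + t)] is medial with mean [0] for every
    bounded [f].  Indeed, doubling [n] times by restricted additivity gives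
    [2^n F(f - f(. + t)) = F(f - f(. + 2^n t))], which stays bounded by
    [2 sup |f|].  Since the envelope satisfies [M^e(f + h) = M^e(f) + M(h)] for
    medial [h], writing [f + f(. + t) = 2f - (f - f(. + t))] yields its
    restricted additivity.  Finally [M_e <= Mlow <= Mup <= M^e] on bounded
    functions, so the envelopes can agree only at medial functions. *)

Import Order.TTheory GRing.Theory Num.Theory.
Import numFieldNormedType.Exports.

(** * Closure properties of bounded functions *)

Section BoundedFunctions.
Set Implicit Arguments. Unset Strict Implicit.
Context {G : zmodType} {R : realType}.
Implicit Types f g : G -> R.

Lemma bounded_funE f : bounded_fun f <-> exists k, forall x, `|f x| <= k.
Proof.
split=> [[k [_ kf]]|[k kf]].
  (* [bounded_fun] guarantees the bound only for constants strictly above [k], hence [k + 1]. *)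
  by exists (k + 1) => x; apply: kf => //; rewrite ltrDl.
by exists k; split=> [|m km x _] /=; [exact: num_real|exact: le_trans (ltW km)].
Qed.

Lemma bounded_fun_const (c : R) : bounded_fun ((fun=> c) : G -> R).
Proof. by apply/bounded_funE; exists `|c|. Qed.

Lemma bounded_fun_add f g :
  bounded_fun f -> bounded_fun g -> bounded_fun (fun x => f x + g x).
Proof.
move=> /bounded_funE[k kf] /bounded_funE[l lg].
apply/(@bounded_funE (fun x => f x + g x)); exists (k + l) => x.
exact: le_trans (ler_normD _ _) (lerD (kf x) (lg x)).
Qed.

Lemma bounded_fun_scale (c : R) f :
  bounded_fun f -> bounded_fun (fun x => c * f x).
Proof.
move=> /bounded_funE[k kf].
apply/(@bounded_funE (fun x => c * f x)); exists (`|c| * k) => x.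
by rewrite normrM ler_wpM2l.
Qed.

Lemma bounded_fun_opp f : bounded_fun f -> bounded_fun (fun x => - f x).
Proof.
move=> /bounded_funE[k kf].
by apply/(@bounded_funE (fun x => - f x)); exists k => x; rewrite normrN.
Qed.

Lemma bounded_fun_shift (t : G) f :
  bounded_fun f -> bounded_fun (fun x => f (x + t)).
Proof.
move=> /bounded_funE[k kf].
by apply/(@bounded_funE (fun x => f (x + t))); exists k => x.
Qed.

Lemma bounded_fun_sub f g :
  bounded_fun f -> bounded_fun g -> bounded_fun (fun x => f x - g x).
Proof. by move=> bf /bounded_fun_opp; exact: bounded_fun_add. Qed.

End BoundedFunctions.

(** * Shift differences and conjugation for premeans *)

Section Premeans.
Set Implicit Arguments. Unset Strict Implicit.
Context {G : zmodType} {R : realType}.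
Implicit Types (f g : G -> R) (F : (G -> R) -> R).

(** Monotonicity squeezes [F f] between the values at the constants [- k] and [k], which norming
    fixes. *)
Lemma premean_le_norm F f k : premean F -> (forall x, `|f x| <= k) ->
  `|F f| <= k.
Proof.
move=> preF fk; have bf : bounded_fun f by apply/bounded_funE; exists k.
rewrite ler_norml -{1}(premean_norming preF (- k)) -{2}(premean_norming preF k).
by apply/andP; split; apply: (premean_monotone preF) => //;
  try exact: bounded_fun_const; move=> x; have := fk x; rewrite ler_norml => /andP[].
Qed.

(** Telescoping: with [s = t *+ 2 ^ n] and [g x = f x - f (x + s)], the sum [g x + g (x + s)] equals
    [f x - f (x + s *+ 2)], so each doubling of the shift doubles the value. *)
Lemma premean_sub_shift_iter F (t : G) f n : premean F -> bounded_fun f ->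
  F (fun x => f x - f (x + t *+ 2 ^ n)) = 2 ^+ n * F (fun x => f x - f (x + t)).
Proof.
move=> preF bf; elim: n => [|n IHn]; first by rewrite mul1r.
rewrite exprS -mulrA -IHn -(premean_restricted_additive preF (t *+ 2 ^ n)).
  congr F; apply/funext => x /=.
  by rewrite expnS mul2n -addnn mulrnDr (addrA x) (addrA (f x - _)) subrK.
by apply: bounded_fun_sub => //; exact: bounded_fun_shift.
Qed.

Lemma premean_sub_shift F (t : G) f : premean F -> bounded_fun f ->
  F (fun x => f x - f (x + t)) = 0.
Proof.
move=> preF bf; set a := F _; apply/eqP/contraT => a0.
have /bounded_funE[k kf] := bf.
have a_gt0 : 0 < `|a| by rewrite normr_gt0.
(* The weaker growth [n <= 2 ^ n] suffices: bounded natural multiples of a positive real contradict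
   the archimedean property. *)
have bnd n : n%:R * `|a| <= k + k.
  apply: (@le_trans _ _ (2 ^+ n * `|a|)).
    by rewrite ler_pM2r// -natrX ler_nat ltnW// ltn_expl.
  rewrite -[2 ^+ n]ger0_norm ?exprn_ge0// -normrM.
  rewrite -premean_sub_shift_iter//; apply: premean_le_norm => // x.
  exact: le_trans (ler_normB _ _) (lerD (kf _) (kf _)).
have := bnd (Num.truncn ((k + k) / `|a|)).+1.
by rewrite -ler_pdivlMr// leNgt truncnS_gt.
Qed.

(** Subadditivity for [f] and [- f] gives [0 <= F f + F (- f)]. *)
Lemma upper_mean_conjugate_le F f : upper_mean F -> bounded_fun f ->
  conjugate F f <= F f.
Proof.
move=> [preF subF] bf; have := subF _ _ bf (bounded_fun_opp bf).
have -> : (fun x => f x - f x) = fun=> 0 by apply/funext => x; rewrite subrr.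
by rewrite (premean_norming preF) /conjugate; lra.
Qed.

Lemma lower_mean_conjugate F : upper_mean F -> lower_mean (conjugate F).
Proof.
move=> [preF subF]; rewrite /conjugate; split=> [|f g bf bg]; first split.
- by move=> c; rewrite (premean_norming preF) opprK.
- move=> f g bf bg fg; rewrite lerN2; apply: (premean_monotone preF);
    by [exact: bounded_fun_opp|move=> x; rewrite lerN2].
- move=> c f c0 bf.
  rewrite mulrN -(premean_homogeneous preF) ?bounded_fun_opp//;
    last exact: bounded_fun_opp.
  by congr (- F _); apply/funext => x; rewrite mulrN.
- move=> t f bf.
  rewrite mulrN -(premean_restricted_additive preF t); last exact: bounded_fun_opp.
  by congr (- F _); apply/funext => x; rewrite opprD.
have -> : (fun x => - (f x + g x)) = fun x => - f x + - g x.
  by apply/funext => x; rewrite opprD.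
by rewrite -opprD lerN2; apply: subF; exact: bounded_fun_opp.
Qed.

End Premeans.

(** * Linearity of the mean on its medial functions *)

Section Envelopes.
Set Implicit Arguments. Unset Strict Implicit.
Context {G : zmodType} {R : realType}.
Variables (L : set (G -> R)) (M Mup : (G -> R) -> R).
Hypothesis L_bounded : forall f, L f -> bounded_fun f.
Hypothesis L_closed : submod_closed (fun f => f \in L).
Hypothesis Mup_induces : induces Mup (conjugate Mup) L M.
Implicit Types f g h : G -> R.

Let Mup_upper : upper_mean Mup := induces_upper Mup_induces.
Let Mup_pre : premean Mup := proj1 Mup_upper.

Lemma medial_lin (a : R) f g : L f -> L g -> L (fun x => a * f x + g x).
Proof.
have [_ lin] := L_closed => /mem_set Lf /mem_set Lg.
exact: set_mem (lin a f g Lf Lg).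
Qed.

Lemma medial_scale (a : R) f : L f -> L (fun x => a * f x).
Proof.
have [/set_mem L0 _] := L_closed => Lf.
have -> : (fun x => a * f x) = fun x => a * f x + (0 : G -> R) x.
  by apply/funext => x; rewrite addr0.
exact: medial_lin.
Qed.

Lemma medial_add f g : L f -> L g -> L (fun x => f x + g x).
Proof.
move=> /(medial_lin 1)/[apply].
by under eq_fun do rewrite mul1r.
Qed.

Lemma medial_opp f : L f -> L (fun x => - f x).
Proof. by move=> /(medial_scale (-1)); under eq_fun do rewrite mulN1r. Qed.

Lemma Mup_opp_medial f : L f -> Mup (fun x => - f x) = - Mup f.
Proof.
move=> Lf; rewrite -(proj1 (induces_medial Mup_induces (L_bounded Lf)) Lf).
by rewrite /conjugate opprK.
Qed.

Lemma mean_opp f : L f -> M (fun x => - f x) = - M f.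
Proof.
move=> Lf; have Ln := medial_opp Lf.
by rewrite !(induces_value Mup_induces)// Mup_opp_medial.
Qed.

Lemma mean_add f g : L f -> L g -> M (fun x => f x + g x) = M f + M g.
Proof.
move=> Lf Lg; have Lfg := medial_add Lf Lg.
have [bf bg] := (L_bounded Lf, L_bounded Lg).
rewrite !(induces_value Mup_induces)//; apply/le_anti/andP; split.
  exact: (proj2 Mup_upper).
(* Superadditivity comes from subadditivity for [f + g] and [- f], whose sum is [g]. *)
have := proj2 Mup_upper _ _ (L_bounded Lfg) (bounded_fun_opp bf).
have -> : (fun x => f x + g x - f x) = g by apply/funext => x; ring.
by rewrite Mup_opp_medial//; lra.
Qed.

Lemma mean_scale (c : R) f : 0 <= c -> L f -> M (fun x => c * f x) = c * M f.
Proof.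
move=> c0 Lf; have Lcf := medial_scale c Lf.
rewrite !(induces_value Mup_induces)//; apply: (premean_homogeneous Mup_pre) => //.
exact: L_bounded.
Qed.

Lemma medial_zero_mean f : bounded_fun f ->
  Mup f = 0 -> Mup (fun x => - f x) = 0 -> L f /\ M f = 0.
Proof.
move=> bf f0 nf0; have Lf : L f.
  by apply/(induces_medial Mup_induces bf); rewrite /conjugate f0 nf0 oppr0.
by rewrite (induces_value Mup_induces Lf).
Qed.

Lemma medial_sub_shift (t : G) f : bounded_fun f ->
  L (fun x => f x - f (x + t)) /\ M (fun x => f x - f (x + t)) = 0.
Proof.
move=> bf; apply: medial_zero_mean.
- by apply: bounded_fun_sub => //; exact: bounded_fun_shift.
- exact: premean_sub_shift.
(* The negated shift difference of [f] is the shift difference of [- f]. *)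
under eq_fun do rewrite opprD.
by apply: (@premean_sub_shift _ _ Mup t (fun x => - f x)) => //; exact: bounded_fun_opp.
Qed.

Lemma medial_const (c : R) : L (fun=> c) /\ M (fun=> c) = c.
Proof.
have Lc : L (fun=> c).
  apply/(induces_medial Mup_induces); first exact: bounded_fun_const.
  by rewrite /conjugate !(premean_norming Mup_pre) opprK.
by rewrite (induces_value Mup_induces Lc) (premean_norming Mup_pre).
Qed.

(** * The upper envelope as an upper mean *)

Lemma upper_envelope_le f g : bounded_fun f -> L g -> (forall x, f x <= g x) ->
  upper_envelope L M f <= M g.
Proof.
move=> bf Lg fg; apply: ge_inf; last by exists g.
(* [inf] is meaningful only for a set bounded below; [Mup f] is a lower bound because [M] agrees
   with the monotone [Mup] on medial functions. *)
exists (Mup f) => _ [h [Lh fh] <-]; rewrite (induces_value Mup_induces Lh).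
exact: (premean_monotone Mup_pre bf (L_bounded Lh)).
Qed.

(** With [upper_envelope_le], this characterizes the infimum by inequalities, so the order
    properties below need only medial majorants. *)
Lemma le_upper_envelope f c : bounded_fun f ->
  (forall g, L g -> (forall x, f x <= g x) -> c <= M g) ->
  c <= upper_envelope L M f.
Proof.
move=> bf cM; apply: lb_le_inf => [|_ [g [Lg fg] <-]]; last exact: cM.
(* The set of values is nonempty: a constant bound of [f] is a medial majorant. *)
have /bounded_funE[k kf] := bf; exists (M (fun=> k)), (fun=> k) => //.
split=> [|x]; first by have [] := medial_const k.
exact: le_trans (ler_norm _) (kf x).
Qed.

Lemma le_Mup_upper_envelope f : bounded_fun f -> Mup f <= upper_envelope L M f.
Proof.
move=> bf; apply: le_upper_envelope => // g Lg fg.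
rewrite (induces_value Mup_induces Lg).
exact: (premean_monotone Mup_pre bf (L_bounded Lg)).
Qed.

Lemma upper_envelope_medial f : L f -> upper_envelope L M f = M f.
Proof.
move=> Lf; have bf := L_bounded Lf; apply/le_anti/andP; split.
  exact: upper_envelope_le.
by rewrite (induces_value Mup_induces Lf) le_Mup_upper_envelope.
Qed.

Lemma upper_envelope_mono f g : bounded_fun f -> bounded_fun g ->
  (forall x, f x <= g x) -> upper_envelope L M f <= upper_envelope L M g.
Proof.
move=> bf bg fg; apply: le_upper_envelope => // h Lh gh.
by apply: upper_envelope_le => // x; exact: le_trans (gh x).
Qed.

Lemma upper_envelope_subadd f g : bounded_fun f -> bounded_fun g ->
  upper_envelope L M (fun x => f x + g x) <=
  upper_envelope L M f + upper_envelope L M g.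
Proof.
(* Isolating one envelope at a time on the right lets the majorants [h] of [g] and [k] of [f] be
   chosen in turn; then [k + h] is a medial majorant of [f + g]. *)
move=> bf bg; rewrite -lerBlDl; apply: le_upper_envelope => // h Lh gh.
rewrite lerBlDr -lerBlDl; apply: le_upper_envelope => // k Lk fk.
rewrite lerBlDr addrC -mean_add//; apply: upper_envelope_le.
- exact: bounded_fun_add.
- exact: medial_add.
by move=> x; rewrite addrC lerD.
Qed.

Lemma upper_envelope_homogeneous (c : R) f : 0 <= c -> bounded_fun f ->
  upper_envelope L M (fun x => c * f x) = c * upper_envelope L M f.
Proof.
rewrite le_eqVlt => /predU1P[<-|c0] bf.
  have [L0 M0] := medial_const 0.
  under eq_fun do rewrite mul0r.
  by rewrite upper_envelope_medial// M0 mul0r.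
(* For a positive factor one inequality is enough: the other is the same statement for [c^-1] and
   [c * f]. *)
have le_scale (a : R) g : 0 < a -> bounded_fun g ->
    upper_envelope L M (fun x => a * g x) <= a * upper_envelope L M g.
  move=> a0 bg; rewrite -ler_pdivrMl//; apply: le_upper_envelope => // h Lh gh.
  rewrite ler_pdivrMl// -mean_scale ?(ltW a0)//; apply: upper_envelope_le.
  - exact: bounded_fun_scale.
  - exact: medial_scale.
  by move=> x; rewrite ler_pM2l.
apply/le_anti/andP; split; first exact: le_scale.
rewrite -ler_pdivlMl//.
have cV0 : 0 < c^-1 by rewrite invr_gt0.
have := le_scale c^-1 _ cV0 (bounded_fun_scale c bf).
by under eq_fun do rewrite mulKf ?gt_eqF//.
Qed.

(** Subadditivity is used twice, for [f] and [h], then for [f + h] and [- h]; on [h] and [- h] the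
    envelope is the linear [M]. *)
Lemma upper_envelope_add_medial f h : bounded_fun f -> L h ->
  upper_envelope L M (fun x => f x + h x) = upper_envelope L M f + M h.
Proof.
move=> bf Lh; have bh := L_bounded Lh; have Lnh := medial_opp Lh.
apply/le_anti/andP; split.
  by rewrite -(upper_envelope_medial Lh) upper_envelope_subadd.
have := upper_envelope_subadd (bounded_fun_add bf bh) (L_bounded Lnh).
under eq_fun do rewrite addrK.
by rewrite (upper_envelope_medial Lnh) mean_opp// lerBrDr.
Qed.

Lemma upper_envelope_restricted_additive (t : G) f : bounded_fun f ->
  upper_envelope L M (fun x => f x + f (x + t)) = 2 * upper_envelope L M f.
Proof.
move=> bf; have [Lh Mh] := medial_sub_shift t bf.
have -> : (fun x => f x + f (x + t)) =
    fun x => 2 * f x + - (f x - f (x + t)) by apply/funext => x; ring.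
rewrite (@upper_envelope_add_medial _ (fun x => - (f x - f (x + t))));
  [|exact: bounded_fun_scale|exact: medial_opp].
by rewrite upper_envelope_homogeneous// mean_opp// Mh oppr0 addr0.
Qed.

Lemma upper_mean_upper_envelope : upper_mean (upper_envelope L M).
Proof.
split; last exact: upper_envelope_subadd.
split.
- by move=> c; have [Lc Mc] := medial_const c; rewrite upper_envelope_medial.
- exact: upper_envelope_mono.
- exact: upper_envelope_homogeneous.
exact: upper_envelope_restricted_additive.
Qed.

(** * Conjugacy of the envelopes and their medial functions *)

Lemma lower_envelopeE : lower_envelope L M = conjugate (upper_envelope L M).
Proof.
(* Since [inf] is defined as minus the [sup] of the negated set, the signs cancel and two sets under
   [sup] remain; negation exchanges medial minorants of [f] with medial majorants of [- f]. *)
apply/funext => f; rewrite /lower_envelope /conjugate /upper_envelope /inf opprK.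
congr sup; apply/seteqP; split=> [_ [g [Lg gf] <-]|_ [_ [g [Lg fg] <-] <-]].
  exists (M (fun x => - g x)); last by rewrite mean_opp// opprK.
  exists (fun x => - g x) => //; split; first exact: medial_opp.
  by move=> x; rewrite lerN2.
exists (fun x => - g x); last exact: mean_opp.
by split=> [|x]; [exact: medial_opp|rewrite lerNl].
Qed.

Lemma medial_upper_envelope f : bounded_fun f ->
  L f <-> conjugate (upper_envelope L M) f = upper_envelope L M f.
Proof.
move=> bf; split=> [Lf|eqf].
  have Ln := medial_opp Lf.
  by rewrite /conjugate !upper_envelope_medial// mean_opp// opprK.
apply/(induces_medial Mup_induces bf); apply/le_anti/andP; split.
  exact: upper_mean_conjugate_le.
(* The missing inequality is the chain [Mup f <= M^e f = - M^e (- f) <= - Mup (- f)], whose equality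
   is the hypothesis [eqf]. *)
apply: le_trans (le_Mup_upper_envelope bf) _; rewrite -eqf /conjugate lerN2.
by apply: le_Mup_upper_envelope; exact: bounded_fun_opp.
Qed.

End Envelopes.

Theorem theorem3p7 (R : realType) (G : zmodType)
    (Ginf : infinite_set [set: G])
    (L : set (G -> R)) (M : (G -> R) -> R) (meanM : is_mean L M) :
  [/\ upper_mean (upper_envelope L M),
      lower_mean (lower_envelope L M)
    & induces (upper_envelope L M) (lower_envelope L M) L M].
Proof.
have [L_bounded L_closed [Mup Mup_induces]] := meanM.
have upM := upper_mean_upper_envelope L_bounded L_closed Mup_induces.
(* Once the lower envelope is written as a conjugate, the lower mean property is inherited from the
   upper envelope and the conjugacy clause of [induces] is trivial. *)
rewrite (lower_envelopeE L_bounded L_closed Mup_induces).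
split=> //; first exact: lower_mean_conjugate.
split=> // f; first exact: (medial_upper_envelope L_bounded L_closed Mup_induces).
by move=> Lf; rewrite (upper_envelope_medial L_bounded Mup_induces).
Qed.
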